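(* Let $\alpha_i\ge 0$, $\beta_i>0$ ($1\le i\le 5$) and $Q>0$ be real numbers, and consider the networks $N$ and $N^+$ with these parameters and total flow $Q$. Braess' paradox may occur in $N/N^+$ in the following cases only; that is, if $T^+_{Eq}>T_{Eq}$, then one of the following holds: (a) at equilibria, both $N$ and $N^+$ have no paths with vanishing flow; (b) at equilibria, $N$ has no path with vanishing flow, and $P_3$ is the only path with non-vanishing flow in $N^+$; (c) at equilibria, $N$ has no path with vanishing flow, and $P_1$ is the only path with vanishing flow in $N^+$; (d) at equilibria, $N$ has no path with vanishing flow, and $P_2$ is the only path with vanishing flow in $N^+$.
   Context: The network $N^+$ has nodes $a,b,c,d$ and directed links $(a,b),(b,d),(b,c),(a,c),(c,d)$ with travel times $\alpha_1+\beta_1f_{ab}$, $\alpha_2+\beta_2f_{bd}$, $\alpha_3+\beta_3f_{bc}$, $\alpha_4+\beta_4f_{ac}$, $\alpha_5+\beta_5f_{cd}$ respectively, where $f_{ij}\ge 0$ is the (real) flow on link $(i,j)$ and $\alpha_i\ge 0$, $\beta_i>0$. All traffic, of total amount $Q>0$ (real), goes from $a$ to $d$ along the paths $P_1=a-b-d$, $P_2=a-c-d$, $P_3=a-b-c-d$. The network $N$ is $N^+$ with the link $(b,c)$ removed, so its paths are $P_1,P_2$ only. A flow assigns a non-negative real amount to each path, with total $Q$; the flow on a link is the sum of the flows of the paths containing it; the travel time on a path is the sum of the travel times of its links. A path has vanishing flow if its path flow is $0$, and non-vanishing flow otherwise. A network is at equilibrium if all paths with non-vanishing flow have the same travel time,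 and every path with vanishing flow has travel time at least this common value. The equilibrium exists and is unique; its common travel time is denoted $T_{Eq}$ for $N$ and $T^+_{Eq}$ for $N^+$. Braess' paradox is said to occur in $N/N^+$ for the total flow $Q$ if $T^+_{Eq}>T_{Eq}$. *)

(* Defs.v *)
From HB Require Import structures.
From mathcomp Require Import all_boot all_order all_algebra.
From mathcomp Require Import reals.

Set Implicit Arguments.
Unset Strict Implicit.
Unset Printing Implicit Defensive.

Import Order.TTheory GRing.Theory Num.Theory.
Local Open Scope ring_scope.

(* The constructors are listed in the order of the indices 1, ..., 5 of the
   parameters alpha_i, beta_i; parameters are then functions on links, e.g.
   alpha_2 is [alpha bd]. *)
Inductive link : Set := ab | bd | bc | ac | cd.

Definition link_eq_dec (x y : link) : {x = y} + {x <> y}.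
Proof. decide equality. Defined.

HB.instance Definition _ := hasDecEq.Build link (compareP link_eq_dec).

Inductive route : Set := P1 | P2 | P3.

Definition route_eq_dec (x y : route) : {x = y} + {x <> y}.
Proof. decide equality. Defined.

HB.instance Definition _ := hasDecEq.Build route (compareP route_eq_dec).

Definition links (p : route) : seq link :=
  match p with
  | P1 => [:: ab; bd]
  | P2 => [:: ac; cd]
  | P3 => [:: ab; bc; cd]
  end.

(* A network is represented by the list of its paths from a to d. *)
Definition netN : seq route := [:: P1; P2].
Definition netNplus : seq route := [:: P1; P2; P3].

Section Traffic.
Variables (R : realType) (alpha beta : link -> R).

(* Path flows are functions on all three paths; every definition below reads
   only the values at the paths of [net], so for [netN] the value at P3 is
   irrelevant. *)
Definition is_flow (net : seq route) (Q : R) (f : route -> R) : Prop :=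
  (forall p, p \in net -> 0 <= f p) /\ \sum_(p <- net) f p = Q.

Definition link_flow (net : seq route) (f : route -> R) (l : link) : R :=
  \sum_(p <- net | l \in links p) f p.

Definition link_time (net : seq route) (f : route -> R) (l : link) : R :=
  alpha l + beta l * link_flow net f l.

Definition route_time (net : seq route) (f : route -> R) (p : route) : R :=
  \sum_(l <- links p) link_time net f l.

Definition vanishing (f : route -> R) (p : route) : bool := f p == 0.

(* [f] is an equilibrium flow of [net] for the total flow [Q], and [T] is its
   common travel time. When 0 < Q some path has non-vanishing flow, so [T] is
   determined by [f]. *)
Definition equilibrium (net : seq route) (Q : R) (f : route -> R) (T : R)
    : Prop :=
  [/\ is_flow net Q f,
      forall p, p \in net -> ~~ vanishing f p -> route_time net f p = T
    & forall p, p \in net -> vanishing f p -> T <= route_time net f p].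

End Traffic.

(* Main.v *)
(* An equilibrium time is at most the travel time of every path.  Hence, if
   T+ > T, a path p in {P1, P2} used in N satisfies f p < f+ p + f+ P3:
   otherwise each of its links carries in N+ at most its flow in N, and T+ is at
   most the time of p in N+, which is at most its time T in N.  Conservation of
   the total Q then excludes both an unused path in N and f+ P3 = 0. *)

Require Import Defs.
From HB Require Import structures.
From mathcomp Require Import all_boot all_order all_algebra.
From mathcomp Require Import reals.
From mathcomp Require Import lra.

Set Implicit Arguments.
Unset Strict Implicit.
Unset Printing Implicit Defensive.

Import Order.TTheory GRing.Theory Num.Theory.
Local Open Scope ring_scope.

Lemma equilibrium_le_route_time (R : realType) (alpha beta : link -> R)
    (net : seq route) (Q : R) (f : route -> R) (T : R) (p : route) :
  equilibrium alpha beta net Q f T -> p \in net ->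
  T <= route_time alpha beta net f p.
Proof.
case=> _ time_used time_unused pnet.
have [/(time_unused p pnet)//|/(time_used p pnet)->//] := boolP (vanishing f p).
Qed.

Lemma route_time_netN_P1 (R : realType) (alpha beta : link -> R) f :
  route_time alpha beta netN f P1 =
  alpha ab + beta ab * f P1 + (alpha bd + beta bd * f P1).
Proof.
by rewrite /route_time /link_time /link_flow !(big_cons, big_nil) /= !addr0.
Qed.

Lemma route_time_netN_P2 (R : realType) (alpha beta : link -> R) f :
  route_time alpha beta netN f P2 =
  alpha ac + beta ac * f P2 + (alpha cd + beta cd * f P2).
Proof.
by rewrite /route_time /link_time /link_flow !(big_cons, big_nil) /= !addr0.
Qed.

Lemma route_time_netNplus_P1 (R : realType) (alpha beta : link -> R) f :
  route_time alpha beta netNplus f P1 =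
  alpha ab + beta ab * (f P1 + f P3) + (alpha bd + beta bd * f P1).
Proof.
by rewrite /route_time /link_time /link_flow !(big_cons, big_nil) /= !addr0.
Qed.

Lemma route_time_netNplus_P2 (R : realType) (alpha beta : link -> R) f :
  route_time alpha beta netNplus f P2 =
  alpha ac + beta ac * f P2 + (alpha cd + beta cd * (f P2 + f P3)).
Proof.
by rewrite /route_time /link_time /link_flow !(big_cons, big_nil) /= !addr0.
Qed.

Theorem mainTheorem1 (R : realType) (alpha beta : link -> R) (Q : R)
    (alpha_ge0 : forall l, 0 <= alpha l) (beta_gt0 : forall l, 0 < beta l)
    (Q_gt0 : 0 < Q)
    (f : route -> R) (TEq : R) (eqN : equilibrium alpha beta netN Q f TEq)
    (fplus : route -> R) (TEqplus : R)
    (eqNplus : equilibrium alpha beta netNplus Q fplus TEqplus)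
    (braess : TEqplus > TEq) :
  [\/ (forall p, p \in netN -> ~~ vanishing f p) /\
        (forall p, p \in netNplus -> ~~ vanishing fplus p),
      (forall p, p \in netN -> ~~ vanishing f p) /\
        (forall p, p \in netNplus -> ~~ vanishing fplus p = (p == P3)),
      (forall p, p \in netN -> ~~ vanishing f p) /\
        (forall p, p \in netNplus -> vanishing fplus p = (p == P1))
    | (forall p, p \in netN -> ~~ vanishing f p) /\
        (forall p, p \in netNplus -> vanishing fplus p = (p == P2))].
Proof.
have le1 := equilibrium_le_route_time eqNplus (isT : P1 \in netNplus).
have le2 := equilibrium_le_route_time eqNplus (isT : P2 \in netNplus).
case: eqN => -[f_ge0 f_sum] f_time _.
case: eqNplus => -[g_ge0 g_sum] _ _.
have t1 := f_time P1 isT; have t2 := f_time P2 isT.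
have x1 := f_ge0 P1 isT; have x2 := f_ge0 P2 isT.
have y1 := g_ge0 P1 isT; have y2 := g_ge0 P2 isT; have y3 := g_ge0 P3 isT.
rewrite route_time_netNplus_P1 in le1; rewrite route_time_netNplus_P2 in le2.
rewrite route_time_netN_P1 in t1; rewrite route_time_netN_P2 in t2.
rewrite !big_cons big_nil addr0 in f_sum.
rewrite !big_cons big_nil addr0 in g_sum.
have more1 : ~~ vanishing f P1 -> f P1 < fplus P1 + fplus P3.
  move=> /t1 T1; rewrite ltNge; apply/negP => le13.
  (* The negated goal bounds the flow on [ab]; dropping the non-negative [fplus P3] gives the bound
     for [bd], which only [P1] uses. *)
  have le11 : fplus P1 <= f P1 by lra.
  (* Scaling by [beta] must be done by hand; [lra] then treats the products as atoms and closes the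
     cycle [TEqplus] <= time in N+ <= time in N = [TEq]. *)
  have := ler_wpM2l (ltW (beta_gt0 ab)) le13.
  have := ler_wpM2l (ltW (beta_gt0 bd)) le11.
  lra.
have more2 : ~~ vanishing f P2 -> f P2 < fplus P2 + fplus P3.
  move=> /t2 T2; rewrite ltNge; apply/negP => le23.
  (* Mirror image of [more1]: here [cd] is shared with [P3] and [ac] is not. *)
  have le22 : fplus P2 <= f P2 by lra.
  have := ler_wpM2l (ltW (beta_gt0 cd)) le23.
  have := ler_wpM2l (ltW (beta_gt0 ac)) le22.
  lra.
have used1 : ~~ vanishing f P1.
  apply/eqP => fP1.
  have /more2 : ~~ vanishing f P2 by apply/eqP => fP2; lra.
  lra.
have used2 : ~~ vanishing f P2.
  by apply/eqP => fP2; have := more1 used1; lra.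
have used3 : ~~ vanishing fplus P3.
  (* If [fplus P3] were zero, adding the two strict inequalities would give [Q < Q]. *)
  by apply/eqP => gP3; have := more1 used1; have := more2 used2; lra.
have usedN : forall p, p \in netN -> ~~ vanishing f p by case.
(* Only [P1] and [P2] can still vanish in N+: both, [P1] alone, [P2] alone and neither yield (b),
   (c), (d) and (a) in turn. *)
have [v1|u1] := boolP (vanishing fplus P1);
  have [v2|u2] := boolP (vanishing fplus P2).
- by apply: Or42; split=> // -[] _; rewrite ?v1 ?v2 ?used3.
- by apply: Or43; split=> // -[] _; rewrite ?v1 ?(negbTE u2) ?(negbTE used3).
- by apply: Or44; split=> // -[] _; rewrite ?v2 ?(negbTE u1) ?(negbTE used3).
- by apply: Or41; split=> // -[].
Qed.
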